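(* Let $G$ be a countable discrete amenable group. Then every $1$-cocycle $c\colon G\to \ell^2 G$ is either bounded or proper.
   Context: $\ell^2 G$ is a $G$-module via the left regular representation. A $1$-cocycle $c\colon G\to\ell^2 G$ is a map with $c(gh)=g\cdot c(h)+c(g)$ for all $g,h\in G$. It is bounded if $\sup_{g\in G}\|c(g)\|_2<\infty$, and proper if for every $C>0$ the set $\{g\in G: \|c(g)\|_2\le C\}$ is finite (equivalently, $\{\|c(g_n)\|_2 : n\in\mathbb N\}$ is unbounded for every sequence $(g_n)$ in $G$ tending to infinity). *)

(* Defs.v *)
From HB Require Import structures.
From mathcomp Require Import all_boot all_order all_algebra.
From mathcomp Require Import all_classical all_reals all_analysis.
From mathcomp Require Import complex.
Set Implicit Arguments.
Unset Strict Implicit.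
Unset Printing Implicit Defensive.
Import Order.TTheory GRing.Theory Num.Theory.
Import numFieldNormedType.Exports.
Local Open Scope classical_set_scope.
Local Open Scope ring_scope.

Definition left_translate (G : groupType) (T : Type) (g : G) (f : G -> T) :
  G -> T := fun x => f (g^-1 * x)%g.

(** A (left-)invariant mean on the bounded real-valued functions on [G].  The
    functional is a total function on [G -> R], but it is constrained only on
    bounded functions; its values elsewhere are irrelevant. *)
Definition invariant_mean (R : realType) (G : groupType)
    (m : (G -> R) -> R) : Prop :=
  [/\ forall (a : R) (f h : G -> R), bounded_fun f -> bounded_fun h ->
        m (fun x => a * f x + h x) = a * m f + m h,
      forall f : G -> R, bounded_fun f -> (forall x, 0 <= f x) -> 0 <= m f,
      m (fun=> 1) = 1 &
      forall (g : G) (f : G -> R), bounded_fun f ->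
        m (left_translate g f) = m f].

Definition amenable (R : realType) (G : groupType) : Prop :=
  exists m : (G -> R) -> R, invariant_mean m.

Definition l2norm_sq (R : realType) (G : groupType) (f : G -> R[i]) : \bar R :=
  (\esum_(x in [set: G]) (ComplexField.Normc.normc (f x) ^+ 2)%:E)%E.

Definition ell2 (R : realType) (G : groupType) : set (G -> R[i]) :=
  [set f | (l2norm_sq f < +oo)%E].

(** Meaningful for [f] in [ell2 R G] only: [fine] sends [+oo] to [0]. *)
Definition l2norm (R : realType) (G : groupType) (f : G -> R[i]) : R :=
  Num.sqrt (fine (l2norm_sq f)).

Definition l2_cocycle (R : realType) (G : groupType)
    (c : G -> (G -> R[i])) : Prop :=
  (forall g, ell2 (c g)) /\
  (forall g h x, c (g * h)%g x = left_translate g (c h) x + c g x).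

Definition bounded_cocycle (R : realType) (G : groupType)
    (c : G -> (G -> R[i])) : Prop :=
  has_ubound [set l2norm (c g) | g in [set: G]].

Definition proper_cocycle (R : realType) (G : groupType)
    (c : G -> (G -> R[i])) : Prop :=
  forall C : R, 0 < C -> finite_set [set g | l2norm (c g) <= C].

(* Main.v *)
Require Import Defs.
From mathcomp Require Import all_boot all_order all_algebra.
From mathcomp Require Import all_classical all_reals all_analysis.
From mathcomp Require Import complex.
From mathcomp Require Import ring lra.
Set Implicit Arguments.
Unset Strict Implicit.
Unset Printing Implicit Defensive.
Import Order.TTheory GRing.Theory Num.Theory.
Local Open Scope ring_scope.

(** Write [c g = g f - f] with [f x = - c x x], and treat the real and imaginary
    parts of [f] separately.  Suppose [||c h||^2 <= C] for infinitely many [h].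
    Choose [N] of them, let [A] be the average of their left translations and
    put [beta = f - A f], so that [||beta||^2 <= C].  We show that
    [c g - (g beta - beta)] is pointwise small, whence [||c g||^2 <= 8 C + 1].

    Let [F] be a Folner set, and let [a] be supported on [F] with [f * a]
    vanishing on the boundary of [F]; this costs few linear conditions.  Then
    [zeta], the restriction of [f * a] to [F], satisfies
    [zeta = A zeta + beta * a] on [F].  The normalized Hilbert-Schmidt norms of
    [A] and of the convolution by [beta] on [F] are at most [N^(-1/2)] and
    [C^(1/2)], so off a subspace of small relative dimension [zeta] is bounded
    by [a] and [A zeta] is small.  But [A zeta] measures the defect
    [(c g - (g beta - beta)) * a = g (A zeta) - A zeta].  The projection onto
    the admissible [a] has almost full trace, so some [a] is close to a point
    mass, and evaluating the defect at that [a] recovers its values.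

    Folner sets come from the invariant mean by a Hahn-Banach argument on
    finitely supported functions: if every finite set has large boundary, then
    some bounded functions [h_b] have [sum_b (h_b (b x) - h_b x) >= e > 0] for
    all [x], and the mean of the left side is zero. *)

(** * Cauchy-Schwarz for finite sums *)

Section FiniteSums.
Variables (R : realFieldType) (I : Type).
Implicit Types (r : seq I) (u v : I -> R).

Lemma sum_sqr_ge0 r u : 0 <= \sum_(i <- r) u i ^+ 2.
Proof. by apply: sumr_ge0 => i _; exact: sqr_ge0. Qed.

Lemma cauchy_schwarz r u v :
  (\sum_(i <- r) u i * v i) ^+ 2 <=
  (\sum_(i <- r) u i ^+ 2) * (\sum_(i <- r) v i ^+ 2).
Proof.
set a := \sum_(i <- r) u i * v i; set b := \sum_(i <- r) u i ^+ 2.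
set d := \sum_(i <- r) v i ^+ 2.
have quad t : 0 <= t ^+ 2 * b + 2 * t * a + d.
  have -> : t ^+ 2 * b + 2 * t * a + d = \sum_(i <- r) (t * u i + v i) ^+ 2.
    rewrite /a /b /d !big_distrr /= -!big_split /=.
    by apply: eq_bigr => i _; ring.
  exact: sum_sqr_ge0.
have b0 : 0 <= b by exact: sum_sqr_ge0.
have d0 : 0 <= d by exact: sum_sqr_ge0.
case: (eqVneq b 0) => [bE|bN].
  have /eqP a0 : a == 0.
    apply/negPn/negP => aN.
    (* With [b = 0] the quadratic is affine in [t], and this [t] gives it the value -1. *)
    have := quad (- (d + 1) / (2 * a)).
    have -> : 2 * (- (d + 1) / (2 * a)) * a = - (d + 1) by field.
    by rewrite bE mulr0; lra.
  by rewrite a0 expr0n bE mul0r.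
have bp : 0 < b by rewrite lt_neqAle eq_sym bN b0.
have := quad (- a / b).
have -> : (- a / b) ^+ 2 * b + 2 * (- a / b) * a + d = d - a ^+ 2 / b by field.
by rewrite subr_ge0 ler_pdivrMr // mulrC.
Qed.

End FiniteSums.

(** * Orthogonal projections, traces and Hilbert-Schmidt norms *)

Section Projections.
Variable R : realType.

Definition sqn m n (A : 'M[R]_(m, n)) : R := \tr (A *m A^T).

Lemma sqnE m n (A : 'M[R]_(m, n)) : sqn A = \sum_i \sum_j A i j ^+ 2.
Proof.
rewrite /sqn /mxtrace; apply: eq_bigr => i _; rewrite mxE.
by apply: eq_bigr => j _; rewrite mxE expr2.
Qed.

Lemma sqn_ge0 m n (A : 'M[R]_(m, n)) : 0 <= sqn A.
Proof. by rewrite sqnE; apply: sumr_ge0 => i _; exact: sum_sqr_ge0. Qed.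

Lemma sqn_colE n (a : 'cV[R]_n) : sqn a = \sum_i a i 0 ^+ 2.
Proof. by rewrite sqnE; apply: eq_bigr => i _; rewrite big_ord1. Qed.

Lemma sqn_col_neq0 n (a : 'cV[R]_n) : a != 0 -> sqn a != 0.
Proof.
apply: contra_neq; rewrite sqn_colE => /eqP.
rewrite psumr_eq0 => [/allP a0|i _]; last exact: sqr_ge0.
apply/colP => i; rewrite mxE; apply/eqP.
by have := a0 i (mem_index_enum _); rewrite /= sqrf_eq0.
Qed.

Lemma sqn_tr_mul n (a : 'cV[R]_n) : a^T *m a = (sqn a)%:M.
Proof. by rewrite [LHS]mx11_scalar /sqn mxtrace_mulC trace_mx11. Qed.

Definition orthoproj n (P : 'M[R]_n) : Prop := P^T = P /\ P *m P = P.

(** For nonzero [u] in the range of [P], the projection onto the part of that range orthogonal to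
    [u]. *)
Definition deflate n (P : 'M[R]_n) (u : 'cV[R]_n) : 'M[R]_n :=
  P - (sqn u)^-1 *: (u *m u^T).

Section Deflate.
Variables (n : nat) (P : 'M[R]_n) (u : 'cV[R]_n).
Hypotheses (hP : orthoproj P) (Pu : P *m u = u) (u0 : u != 0).

Let uP : u^T *m P = u^T.
Proof. by rewrite -{2}Pu trmx_mul hP.1. Qed.

Let k0 : sqn u != 0. Proof. exact: sqn_col_neq0. Qed.

Let dyad_idem : (sqn u)^-1 *: (u *m u^T) *m ((sqn u)^-1 *: (u *m u^T)) =
  (sqn u)^-1 *: (u *m u^T).
Proof.
rewrite -scalemxAl -scalemxAr -!mulmxA (mulmxA u^T) sqn_tr_mul.
by rewrite mul_scalar_mx -scalemxAr scalerA mulVf // scale1r.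
Qed.

Lemma deflate_proj : orthoproj (deflate P u).
Proof.
split; rewrite /deflate.
  by rewrite linearB linearZ /= trmx_mul trmxK hP.1.
rewrite mulmxBl !mulmxBr hP.2 dyad_idem -scalemxAr -scalemxAl.
by rewrite mulmxA Pu -mulmxA uP subrr subr0.
Qed.

Lemma deflate_mull : P *m deflate P u = deflate P u.
Proof. by rewrite /deflate mulmxBr hP.2 -scalemxAr mulmxA Pu. Qed.

Lemma deflate_mulr : deflate P u *m P = deflate P u.
Proof. by rewrite /deflate mulmxBl hP.2 -scalemxAl -mulmxA uP. Qed.

Lemma deflate_kill : deflate P u *m u = 0.
Proof.
rewrite /deflate mulmxBl Pu -scalemxAl -mulmxA sqn_tr_mul mul_mx_scalar.
by rewrite scalerA mulVf // scale1r subrr.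
Qed.

Lemma tr_deflate : \tr (deflate P u) = \tr P - 1.
Proof. by rewrite /deflate linearB linearZ /= -/(sqn u) mulVf. Qed.

Lemma deflate_fix (b : 'cV[R]_n) :
  P *m b = b -> u^T *m b = 0 -> deflate P u *m b = b.
Proof.
by move=> Pb ub; rewrite /deflate mulmxBl Pb -scalemxAl -mulmxA ub mulmx0 scaler0 subr0.
Qed.

(** For a projection [Q], the squared norm of [A Q] is the trace of [A Q A^T], which is linear in
    [Q]. *)
Lemma sqn_deflate m (A : 'M[R]_(m, n)) :
  sqn (A *m deflate P u) = sqn (A *m P) - sqn (A *m u) / sqn u.
Proof.
have sq (Q : 'M[R]_n) : orthoproj Q -> sqn (A *m Q) = \tr (A *m Q *m A^T).
  by move=> [QT QQ]; rewrite /sqn trmx_mul QT !mulmxA -(mulmxA A Q Q) QQ.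
rewrite !sq //; last exact: deflate_proj.
rewrite /deflate mulmxBr mulmxBl linearB /= -scalemxAr -scalemxAl linearZ /=.
by rewrite /sqn trmx_mul !mulmxA mulrC.
Qed.

End Deflate.

Lemma orthoproj1 n : orthoproj (1%:M : 'M[R]_n).
Proof. by split; rewrite ?trmx1 ?mulmx1. Qed.

Lemma sqn_col_proj n (P : 'M[R]_n) l : orthoproj P -> sqn (col l P) = P l l.
Proof.
move=> [PT PP]; rewrite sqn_colE -[in RHS]PP mxE; apply: eq_bigr => k _.
by rewrite mxE expr2 -{1}PT mxE.
Qed.

Lemma diag_proj_le1 n (P : 'M[R]_n) l : orthoproj P -> P l l <= 1.
Proof.
move=> hP; have := sqn_col_proj l hP; rewrite sqn_colE (bigD1 l) //= mxE => E.
have : 0 <= \sum_(i < n | i != l) col l P i 0 ^+ 2.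
  by apply: sumr_ge0 => i _; exact: sqr_ge0.
nra.
Qed.

(** [1 - P] is again a projection, so its diagonal gives the squared distance from a column of [P]
    to the point mass. *)
Lemma compl_proj_col n (P : 'M[R]_n) l : orthoproj P ->
  \sum_k ((k == l)%:R - P k l) ^+ 2 = 1 - P l l.
Proof.
move=> [PT PP].
have hQ : orthoproj (1%:M - P).
  split; first by rewrite linearB /= trmx1 PT.
  by rewrite mulmxBl mul1mx mulmxBr mulmx1 PP subrr subr0.
have := sqn_col_proj l hQ; rewrite sqn_colE !mxE eqxx => <-.
by apply: eq_bigr => k _; rewrite !mxE.
Qed.

(** Deflating along [P v^T] imposes the condition [v] at the cost of one unit of trace; if
    [P v^T = 0], the condition already holds. *)
Lemma proj_of_constraints n (s : seq 'rV[R]_n) :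
  exists P : 'M[R]_n, [/\ orthoproj P, forall v, v \in s -> v *m P = 0 &
    n%:R - (size s)%:R <= \tr P].
Proof.
elim: s => [|v s [P [hP Ps trP]]].
  by exists 1%:M; split; [exact: orthoproj1|by []|rewrite mxtrace1 subr0].
have [u0|uN] := eqVneq (P *m v^T) 0.
  exists P; split => // [w|].
    rewrite inE => /predU1P[->|/Ps//].
    by rewrite -[v]trmxK -hP.1 -trmx_mul u0 trmx0.
  by apply: le_trans trP; rewrite lerD2l lerN2 ler_nat.
set u := P *m v^T in uN.
have Pu : P *m u = u by rewrite /u mulmxA hP.2.
exists (deflate P u); split.
- exact: deflate_proj.
- move=> w; rewrite inE => /predU1P[->|ws].
    rewrite -[v]trmxK -(deflate_proj hP Pu uN).1 -trmx_mul.
    by rewrite -(deflate_mulr hP Pu) -mulmxA -/u deflate_kill // trmx0.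
  by rewrite -(deflate_mull hP Pu) mulmxA Ps // mul0mx.
- by rewrite tr_deflate //= -natr1; lra.
Qed.

(* Each unit vector violating the bound, orthogonal to the earlier ones, uses up
   [tau] of the Hilbert-Schmidt norm of [A]. *)
Lemma small_off_constraints m n (A : 'M[R]_(m, n)) (tau : R) : 0 < tau ->
  exists s : seq 'rV[R]_n, (size s)%:R * tau <= sqn A /\
    forall a : 'cV[R]_n, (forall v, v \in s -> v *m a = 0) ->
      sqn (A *m a) <= tau * sqn a.
Proof.
move=> tau0; apply: contrapT => noS.
have H k : exists (s : seq 'rV[R]_n) (P : 'M[R]_n), [/\ size s = k, orthoproj P,
    forall a : 'cV[R]_n, (forall v, v \in s -> v *m a = 0) -> P *m a = a &
    sqn (A *m P) + k%:R * tau <= sqn A].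
  elim: k => [|k [s [P [sk hP Pfix Pk]]]].
    exists [::], 1%:M; split => // [|a _|]; first exact: orthoproj1.
      by rewrite mul1mx.
    by rewrite mulmx1 mul0r addr0.
  have [a [sa Aa]] : exists a : 'cV[R]_n,
      (forall v, v \in s -> v *m a = 0) /\ tau * sqn a < sqn (A *m a).
    apply: contrapT => noa; apply: noS; exists s; split.
      by rewrite sk; apply: le_trans Pk; rewrite lerDr sqn_ge0.
    move=> a sa; rewrite leNgt; apply/negP => lt; apply: noa.
    by exists a.
  have a0 : a != 0.
    by apply: contraTneq Aa => ->; rewrite mulmx0 /sqn !mul0mx !mxtrace0 mulr0 ltxx.
  have Pa := Pfix a sa.
  exists (a^T :: s), (deflate P a); split => [|||].
  - by rewrite /= sk.
  - exact: deflate_proj.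
  - move=> b sb; apply: deflate_fix; first by apply: Pfix => v vs; rewrite sb // inE vs orbT.
    by rewrite sb // mem_head.
  - rewrite sqn_deflate // -natr1 mulrDl mul1r; apply: le_trans Pk.
    suff : tau <= sqn (A *m a) / sqn a by lra.
    rewrite ler_pdivlMr ?(ltW Aa) // lt_neqAle eq_sym sqn_ge0 andbT.
    exact: sqn_col_neq0.
(* After more than [sqn A / tau] steps the norm of [A] is exhausted. *)
have [s [P [_ _ _ Hk]]] := H (Num.bound (sqn A / tau)).
have := archi_boundP (divr_ge0 (sqn_ge0 A) (ltW tau0)).
rewrite ltr_pdivrMr // => lt; have := sqn_ge0 (A *m P); lra.
Qed.

End Projections.

(** * Coboundaries and the Folner condition *)

Section CocycleEstimate.
Variables (R : realType) (G : groupType).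
Implicit Types (u v f : G -> R) (g x y : G) (K C e : R).

(** [sqle v K] says that [v] is square-summable with squared norm at most [K]. *)
Definition sqle v K := forall X : seq G, uniq X -> \sum_(x <- X) v x ^+ 2 <= K.

Definition bd g u x := u (g^-1 * x)%g - u x.

(** The Folner set is the image of [z], enumerated so that operators compressed to it become square
    matrices. *)
Definition folner := forall (B : seq G) e, 0 < e ->
  exists (n : nat) (z : 'I_n -> G), [/\ (0 < n)%N, injective z &
    \sum_(b <- B) \sum_(i < n) ((b * z i)%g \notin codom z)%:R <= e * n%:R].

Lemma sqle_inj v K (I : finType) (h : I -> G) :
  sqle v K -> injective h -> \sum_i v (h i) ^+ 2 <= K.
Proof.
move=> vK hinj; rewrite -(big_map h xpredT (fun x => v x ^+ 2)).
by apply: vK; rewrite map_inj_uniq // index_enum_uniq.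
Qed.

Lemma sqle_inj_seq v K (h : G -> G) : sqle v K -> injective h -> sqle (v \o h) K.
Proof.
move=> vK hinj X uX; rewrite -(big_map h xpredT (fun x => v x ^+ 2)).
by apply: vK; rewrite map_inj_uniq.
Qed.

Lemma sqle_bd g u K : sqle u K -> sqle (bd g u) (4 * K).
Proof.
move=> uK X uX.
have H1 := uK X uX.
have H2 : \sum_(x <- X) u (g^-1 * x)%g ^+ 2 <= K.
  exact: (sqle_inj_seq uK (mulgI g^-1)%g uX).
apply: (@le_trans _ _ (2 * \sum_(x <- X) u (g^-1 * x)%g ^+ 2 + 2 * \sum_(x <- X) u x ^+ 2)).
  rewrite !big_distrr -big_split /=; apply: ler_sum => x _.
  by rewrite /bd; have := sqr_ge0 (u (g^-1 * x)%g + u x); nra.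
lra.
Qed.

Definition avg (gs : seq G) u x := (size gs)%:R^-1 * \sum_(h <- gs) u (h^-1 * x)%g.

(** * Pointwise smallness of the defect [w] *)

Section Defect.
Variables (f : G -> R) (gs : seq G) (C W e : R) (g x0 : G).
Hypotheses (ugs : uniq gs) (C0 : 0 < C) (e0 : 0 < e) (e2 : e <= 2^-1).
Let N : R := (size gs)%:R.
Hypothesis Ne : 4 <= N * e.
Let beta x := f x - avg gs f x.
Let w x := bd g f x - bd g beta x.
Hypotheses (betaC : sqle beta C) (wW : sqle w W).

Let N0 : 0 < N.
Proof.
have := ler0n R (size gs); rewrite -/N le_eqVlt => /orP[/eqP NE|//].
by move: Ne; rewrite -NE mul0r; lra.
Qed.

Variables (n : nat) (z : 'I_n -> G).
Hypotheses (n0 : (0 < n)%N) (zinj : injective z).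
(** Translates by [h^-1] occur in the averages, those by the last two elements in evaluating the
    defect. *)
Let B := [seq h^-1%g | h <- gs] ++ [:: x0; (g^-1 * x0)%g].
Hypothesis fol :
  \sum_(b <- B) \sum_(i < n) ((b * z i)%g \notin codom z)%:R <= e * n%:R.

(** Convolution of [u] with the function taking the value [a k 0] at [z k]. Below, [Z] and [Bm]
    compress convolution by [f] and [beta] to the Folner set, and [T] compresses [avg gs]. *)
Let conv u (a : 'cV[R]_n) x := \sum_k u (x * (z k)^-1)%g * a k 0.
Let Z : 'M[R]_n := \matrix_(i, k) f (z i * (z k)^-1)%g.
Let Bm : 'M[R]_n := \matrix_(i, k) beta (z i * (z k)^-1)%g.
Let T : 'M[R]_n := \matrix_(i, k) (N^-1 * ((z i * (z k)^-1)%g \in gs)%:R).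

(** Each column of [Bm] lists [beta] at distinct points. *)
Let sqnB : sqn Bm <= n%:R * C.
Proof.
rewrite sqnE exchange_big /=.
apply: (@le_trans _ _ (\sum_(k < n) C)); last by rewrite sumr_const card_ord mulr_natl.
apply: ler_sum => k _; under eq_bigr do rewrite mxE.
by apply: (sqle_inj (h := fun i => (z i * (z k)^-1)%g) betaC) => i j /mulIg/zinj.
Qed.

(** Each row of [T] has at most [N] nonzero entries, all equal to [N^-1]. *)
Let sqnT : sqn T <= n%:R / N.
Proof.
rewrite sqnE; apply: (@le_trans _ _ (\sum_(k < n) N^-1)); last first.
  by rewrite sumr_const card_ord mulr_natl.
apply: ler_sum => i _.
have -> : \sum_(k < n) T i k ^+ 2 =
    N^-1 ^+ 2 * \sum_(k < n) ((z i * (z k)^-1)%g \in gs)%:R.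
  rewrite big_distrr /=; apply: eq_bigr => k _.
  by rewrite mxE exprMn; case: (_ \in gs); rewrite ?expr1n ?expr0n.
suff H : \sum_(k < n) ((z i * (z k)^-1)%g \in gs)%:R <= N.
  rewrite expr2 -mulrA ger_pMr ?invr_gt0 // mulrC ler_pdivrMr // mul1r //.
set q := fun k => (z i * (z k)^-1)%g.
have qinj : injective q by move=> k l /mulgI/invg_inj/zinj.
rewrite -natr_sum /N ler_nat.
have -> : (\sum_k ((q k \in gs) : nat) = #|[pred k | q k \in gs]|)%N.
  by rewrite -sum1_card [RHS]big_mkcond; apply: eq_bigr => k _; rewrite inE; case: (_ \in gs).
rewrite cardE -(size_map q); apply: uniq_leq_size.
  by rewrite map_inj_uniq // enum_uniq.
by move=> y /mapP[k]; rewrite mem_enum => + ->; rewrite inE.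
Qed.

(** One linear condition for each pair whose point [h^-1 z_i] leaves the Folner set: [conv f a]
    vanishes there. *)
Let bdry : seq 'rV[R]_n :=
  [seq \row_k f (p.1 * z p.2 * (z k)^-1)%g |
     p <- [seq p <- [seq (b, i) | b <- [seq h^-1%g | h <- gs], i <- enum 'I_n] |
             (p.1 * z p.2)%g \notin codom z]].

Let size_bdry : (size bdry)%:R <= e * n%:R.
Proof.
apply: le_trans fol; rewrite /B big_cat /= ler_wpDr //.
  by apply: sumr_ge0 => b _; apply: sumr_ge0 => i _; rewrite ler0n.
rewrite size_map size_filter -sum1_count natr_sum big_mkcond big_allpairs /=.
apply: ler_sum => b _; rewrite big_enum /=.
by apply: ler_sum => i _; case: (_ \notin _).
Qed.

Lemma conv_avg u a x : conv (avg gs u) a x = avg gs (conv u a) x.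
Proof.
rewrite /conv /avg exchange_big big_distrr /=; apply: eq_bigr => k _.
rewrite -mulrA big_distrl /=; congr (_ * _).
by apply: eq_bigr => h _; rewrite mulgA.
Qed.

Lemma convB u v a x : conv (fun y => u y - v y) a x = conv u a x - conv v a x.
Proof. by rewrite /conv -sumrB; apply: eq_bigr => k _; rewrite mulrBl. Qed.

Lemma conv_bd u a x : conv (bd g u) a x = bd g (conv u a) x.
Proof.
by rewrite /bd /conv -sumrB; apply: eq_bigr => k _; rewrite mulrBl mulgA.
Qed.

Section Admissible.
Variable a : 'cV[R]_n.
Hypothesis abd : forall r : 'rV[R]_n, r \in bdry -> r *m a = 0.

Let bd0 h i : h \in gs -> (h^-1 * z i)%g \notin codom z -> conv f a (h^-1 * z i)%g = 0.
Proof.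
move=> hgs hi; have : \row_k f (h^-1 * z i * (z k)^-1)%g \in bdry.
  apply/mapP; exists (h^-1%g, i) => //; rewrite mem_filter hi /=.
  by apply/allpairsP; exists (h^-1%g, i); rewrite mem_enum; split => //; apply: map_f.
move=> /abd /(congr1 (fun M : 'M[R]_1 => M 0 0)); rewrite !mxE => <-.
by apply: eq_bigr => k _; rewrite mxE.
Qed.

Let ZaE i : (Z *m a) i 0 = conv f a (z i).
Proof. by rewrite mxE; apply: eq_bigr => k _; rewrite mxE. Qed.

(** Points where the average leaves the Folner set contribute nothing, so truncation does no
    harm. *)
Let TZaE i : (T *m (Z *m a)) i 0 = avg gs (conv f a) (z i).
Proof.
rewrite mxE /avg big_distrr /=.
transitivity (\sum_k \sum_(h <- gs) N^-1 * ((h^-1 * z i == z k)%g%:R * conv f a (z k))).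
  apply: eq_bigr => k _; rewrite mxE ZaE -big_distrr /= -mulrA -big_distrl /=.
  congr (_ * (_ * _)); rewrite -natr_sum; congr _%:R.
  rewrite -(count_uniq_mem _ ugs) -sum1_count big_mkcond /=.
  apply: eq_bigr => h _.
  have -> : (h^-1 * z i == z k)%g = (h == z i * (z k)^-1)%g.
    by apply/eqP/eqP => [<-|->]; rewrite invgM ?invgK ?mulgVK ?mulgA ?mulgV ?mul1g ?mulKg.
  by case: (_ == _).
rewrite exchange_big /=; rewrite !big_seq; apply: eq_bigr => h hgs.
rewrite -big_distrr /=; congr (_ * _).
case: (boolP ((h^-1 * z i)%g \in codom z)) => [/codomP[k kE]|hi].
  rewrite kE (bigD1 k) //= eqxx mul1r big1 ?addr0 // => l lk.
  by rewrite (inj_eq zinj) eq_sym (negbTE lk) mul0r.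
rewrite (bd0 hgs hi) big1 // => k _; case: eqP => [E|_]; last by rewrite mul0r.
by rewrite E codom_f in hi.
Qed.

Let BaE : Bm *m a = Z *m a - T *m (Z *m a).
Proof.
apply/colP => i; rewrite [RHS]mxE [X in _ + X]mxE ZaE TZaE -conv_avg -convB.
by rewrite mxE; apply: eq_bigr => k _; rewrite mxE.
Qed.

Lemma conv_w x : conv w a x = bd g (avg gs (conv f a)) x.
Proof.
rewrite /w convB !conv_bd /bd !convB !conv_avg; ring.
Qed.

(** In [Z a = T (Z a) + Bm a] the first term is absorbed, as [2 t2 <= 1/2]; hence
    [sqn (Z a) <= 4 t1 sqn a], and [T] gains the factor [t2]. *)
Lemma zeta_bound (t1 t2 : R) : 0 <= t1 -> 0 <= t2 <= 4^-1 ->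
  sqn (Bm *m a) <= t1 * sqn a -> sqn (T *m (Z *m a)) <= t2 * sqn (Z *m a) ->
  forall i, (avg gs (conv f a) (z i)) ^+ 2 <= 4 * t1 * t2 * sqn a.
Proof.
move=> t10 /andP[t20 t24] HB HT i.
have tri : sqn (Z *m a) <= 2 * sqn (T *m (Z *m a)) + 2 * sqn (Bm *m a).
  rewrite BaE !sqn_colE !big_distrr -big_split /=; apply: ler_sum => j _.
  rewrite [X in _ <= _ + _ * X ^+ 2]mxE [X in _ <= _ + _ * (_ + X) ^+ 2]mxE.
  have := sqr_ge0 ((Z *m a) j 0 - 2 * (T *m (Z *m a)) j 0); nra.
have Z0 := sqn_ge0 (Z *m a); have a0 := sqn_ge0 a.
have T0 := sqn_ge0 (T *m (Z *m a)).
have Zb : sqn (Z *m a) <= 4 * (t1 * sqn a).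
  have : t2 * sqn (Z *m a) <= 4^-1 * sqn (Z *m a) by rewrite ler_wpM2r.
  lra.
rewrite -TZaE.
apply: (@le_trans _ _ (sqn (T *m (Z *m a)))).
  rewrite sqn_colE (bigD1 i) //= lerDl; exact: sumr_ge0 (fun _ _ => sqr_ge0 _).
apply: (le_trans HT); apply: (le_trans (ler_wpM2l t20 Zb)).
rewrite le_eqVlt; apply/orP; left; apply/eqP; ring.
Qed.

End Admissible.
(** The two terms bound twice the square of [conv w a] at [x0 z_l] and twice the squared error of
    replacing the point mass at [z_l] by [a]. *)
Lemma defect_bound : w x0 ^+ 2 <= 32 * (C / e) * (N * e)^-1 + 14 * e * W.
Proof.
have nR : 0 < n%:R :> R by rewrite ltr0n.
(* With the thresholds [C / e] and [(N e)^-1], each of [Bm] and [T] costs at most [e n]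
   conditions. *)
have t10 : 0 < C / e by exact: divr_gt0.
have Ne0 : 0 < N * e by exact: mulr_gt0.
have t20 : 0 < (N * e)^-1 by rewrite invr_gt0.
have [s1 [sz1 hs1]] := small_off_constraints Bm t10.
have [s2 [sz2 hs2]] := small_off_constraints T t20.
have {}sz1 : (size s1)%:R <= e * n%:R.
  rewrite -(ler_pM2r t10); apply: (le_trans sz1); apply: (le_trans sqnB).
  by rewrite le_eqVlt; apply/orP; left; apply/eqP; field; rewrite gt_eqF.
have {}sz2 : (size s2)%:R <= e * n%:R.
  rewrite -(ler_pM2r t20); apply: (le_trans sz2); apply: (le_trans sqnT).
  rewrite le_eqVlt; apply/orP; left; apply/eqP; field.
  by rewrite !gt_eqF.
have [P [hP Ps trP]] :=
  proj_of_constraints (bdry ++ s1 ++ [seq r *m Z | r <- s2]).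
rewrite !size_cat (size_map _ s2) !natrD in trP.
have [l [l1 l2 lP]] : exists l, [/\ (x0 * z l)%g \in codom z,
    (g^-1 * x0 * z l)%g \in codom z & 1 - P l l <= 7 * e].
  (* All conditions together lower the trace by at most [3 e n], and at most [e n] indices fail a
     membership. If all others had [1 - P l l > 7 e], the loss would be at least
     [7 e (1 - e) n >= 3.5 e n]. *)
  apply: contrapT => nol.
  have lt l : 7 * e * (1 - ((x0 * z l)%g \notin codom z)%:R
      - ((g^-1 * x0 * z l)%g \notin codom z)%:R) <= 1 - P l l.
    have ge0 := diag_proj_le1 l hP; have egt0 := e0.
    have [h1|h1] := boolP ((x0 * z l)%g \in codom z);
      have [h2|h2] := boolP ((g^-1 * x0 * z l)%g \in codom z) => /=; try lra.
    rewrite !subr0 mulr1 leNgt; apply/negP => h3; apply: nol; exists l.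
    by split => //; exact: ltW.
  have := ler_sum (index_enum _) (fun l (_ : xpredT l) => lt l).
  rewrite -big_distrr /= !sumrB !sumr_const card_ord -/(mxtrace P).
  move: fol; rewrite /B big_cat /= !big_cons big_nil addr0 => fol'.
  have : 0 <= \sum_(b <- [seq h^-1%g | h <- gs])
      \sum_(i < n) ((b * z i)%g \notin codom z)%:R :> R.
    by apply: sumr_ge0 => b _; apply: sumr_ge0 => i _; rewrite ler0n.
  move: fol' => /[swap] S0 fol' lts; have bdn := size_bdry.
  have en0 : 0 < e * n%:R by exact: mulr_gt0.
  have h1 : 0 <= e * n%:R * (2^-1 - e) by rewrite mulr_ge0 ?subr_ge0 // ltW.
  set U := \sum_i _ in lts fol'; set V := \sum_i _ in lts fol'.
  have h2 : 0 <= e * (e * n%:R - U - V).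
    by apply: mulr_ge0; [exact: ltW|lra].
  nra.
pose a := col l P.
have sa : sqn a <= 1.
  by rewrite sqn_col_proj //; have := diag_proj_le1 l hP; lra.
have Pa r : r \in bdry ++ s1 ++ [seq r *m Z | r <- s2] -> r *m a = 0.
  by move=> /Ps rP; rewrite /a colE mulmxA rP mul0mx.
have abd r : r \in bdry -> r *m a = 0.
  by move=> rb; apply: Pa; rewrite mem_cat rb.
have H1 : sqn (Bm *m a) <= C / e * sqn a.
  by apply: hs1 => r rs; apply: Pa; rewrite !mem_cat rs orbT.
have H2 : sqn (T *m (Z *m a)) <= (N * e)^-1 * sqn (Z *m a).
  apply: hs2 => r rs; rewrite mulmxA; apply: Pa.
  by rewrite !mem_cat (map_f (fun r : 'rV[R]_n => r *m Z) rs) !orbT.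
have t24 : 0 <= (N * e)^-1 <= 4^-1.
  by rewrite (ltW t20) /= lef_pV2 // posrE.
have zb := zeta_bound abd (ltW t10) t24 H1 H2.
set D := 4 * (C / e) * (N * e)^-1.
have {}zb i : avg gs (conv f a) (z i) ^+ 2 <= D.
  apply: (le_trans (zb i)); rewrite -[leRHS]mulr1; apply: ler_wpM2l => //.
  by rewrite mulr_ge0 ?(ltW t20) // mulr_ge0 ?(ltW t10).
have wa : conv w a (x0 * z l)%g ^+ 2 <= 4 * D.
  rewrite conv_w /bd mulgA.
  move/codomP: l1 => [i ->]; move/codomP: l2 => [j ->].
  have := zb i; have := zb j.
  have := sqr_ge0 (avg gs (conv f a) (z i) + avg gs (conv f a) (z j)); nra.
(* Convolving [w] with the point mass at [z l] gives exactly [w x0]; Cauchy-Schwarz bounds the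
   error. *)
have wd : (w x0 - conv w a (x0 * z l)%g) ^+ 2 <= W * (7 * e).
  have -> : w x0 - conv w a (x0 * z l)%g =
      \sum_k w (x0 * z l * (z k)^-1)%g * ((k == l)%:R - P k l).
    rewrite /conv; under [RHS]eq_bigr do rewrite mulrBr.
    rewrite sumrB; congr (_ - _); last by apply: eq_bigr => k _; rewrite mxE.
    rewrite (bigD1 l) //= eqxx mulr1 mulgK big1 ?addr0 // => k /negbTE ->.
    by rewrite mulr0.
  apply: le_trans (cauchy_schwarz _ _ _) _.
  apply: ler_pM; try exact: sum_sqr_ge0.
    by apply: (sqle_inj (h := fun k => (x0 * z l * (z k)^-1)%g) wW) => i j /mulgI/invg_inj/zinj.
  by rewrite compl_proj_col.
have := sqr_ge0 (w x0 - 2 * conv w a (x0 * z l)%g).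
rewrite /D in wa *; nra.
Qed.

End Defect.
End CocycleEstimate.

(** * From a small defect to a uniform bound *)

Section Alternative.
Variables (R : realType) (G : groupType).
Implicit Types (u v f : G -> R) (K C : R).

Lemma sqle_ge0 v K : sqle v K -> 0 <= K.
Proof. by move=> /(_ [::] isT); rewrite big_nil. Qed.

Lemma sqle_lin u v s K C : s ^+ 2 = 1 -> sqle u K -> sqle v C ->
  sqle (fun x => u x + s * v x) (2 * K + 2 * C).
Proof.
move=> s1 uK vC X uX; have := uK X uX; have := vC X uX => H1 H2.
apply: (@le_trans _ _ (2 * \sum_(x <- X) u x ^+ 2 + 2 * \sum_(x <- X) v x ^+ 2)).
  rewrite !big_distrr -big_split /=; apply: ler_sum => x _.
  have -> : 2 * v x ^+ 2 = 2 * (s * v x) ^+ 2 by rewrite exprMn s1 mul1r.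
  by have := sqr_ge0 (u x - s * v x); nra.
lra.
Qed.

(** [f - avg gs f] is the mean of the functions [- bd h f], and the squared norm is convex. *)
Lemma sqle_sub_avg f gs C : (0 < size gs)%N ->
  (forall h, h \in gs -> sqle (bd h f) C) -> sqle (fun x => f x - avg gs f x) C.
Proof.
move=> gs0 gsC X uX; set N : R := (size gs)%:R.
have N0 : 0 < N by rewrite ltr0n.
have E x : f x - avg gs f x = N^-1 * \sum_(h <- gs) (- bd h f x).
  rewrite /avg -/N; under [in RHS]eq_bigr do rewrite /bd opprB.
  rewrite sumrB mulrBr; congr (_ - _).
  by rewrite big_const_seq count_predT iter_addr_0 -mulr_natl -/N mulKf // gt_eqF.
apply: (@le_trans _ _ (\sum_(x <- X) N^-1 * \sum_(h <- gs) bd h f x ^+ 2)).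
  apply: ler_sum => x _; rewrite E exprMn expr2 -mulrA ler_pM2l ?invr_gt0 //.
  rewrite ler_pdivrMl //.
  have := cauchy_schwarz gs (fun=> 1) (fun h => - bd h f x).
  under eq_bigr do rewrite mul1r.
  under [X in _ <= X * _ -> _]eq_bigr do rewrite expr1n.
  under [X in _ <= _ * X -> _]eq_bigr do rewrite sqrrN.
  by rewrite [X in _ <= X * _ -> _]big_const_seq count_predT iter_addr_0.
rewrite -big_distrr exchange_big /= ler_pdivrMl //.
apply: (@le_trans _ _ (\sum_(h <- gs) C)).
  by rewrite !big_seq; apply: ler_sum => h hgs; exact: gsC.
by rewrite big_const_seq count_predT iter_addr_0 mulr_natl.
Qed.

(** The bound [K] depends on [g] but only affects the choice of [e] and [gs]. In the result, [8 C]
    comes from [bd g beta] and 1 from the defect. *)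
Lemma bounded_of_infinite f C (fol : folner R G) :
  (forall g, exists K, sqle (bd g f) K) -> 0 < C ->
  ~ finite_set [set g | sqle (bd g f) C] ->
  forall g, sqle (bd g f) (8 * C + 1).
Proof.
move=> fK C0 infS g X uX; have [K gK] := fK g.
have K0 := sqle_ge0 gK.
pose W := 2 * K + 2 * (4 * C) + 1.
have W0 : 0 < W by rewrite /W; lra.
(* A pointwise bound [eta] on the squared defect sums to at most 1/2 over [X]. *)
pose eta : R := (2 * (size X).+1%:R)^-1.
have eta0 : 0 < eta by rewrite invr_gt0 mulr_gt0 // ltr0n.
(* This [e] brings the second term of [defect_bound] below [eta / 2]; [M] then does so for the first
   and ensures [4 <= N e]. *)
pose e := Num.min 2^-1 (eta / (28 * W)).
have e0 : 0 < e by rewrite lt_min invr_gt0 ltr0n /= divr_gt0 // mulr_gt0.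
have e2 : e <= 2^-1 by rewrite ge_min lexx.
have eW : 14 * e * W <= eta / 2.
  have : e <= eta / (28 * W) by rewrite ge_min lexx orbT.
  by rewrite ler_pdivlMr ?mulr_gt0 //; lra.
pose M := Num.max (4 / e) (64 * C / (e ^+ 2 * eta)).
have [B BS BM] := infinite_set_fset (Num.bound M) infS.
pose gs : seq G := finmap.enum_fset B.
have ugs : uniq gs by exact: finmap.fset_uniq.
have gsC h : h \in gs -> sqle (bd h f) C by move=> hB; exact: BS.
have sM : M < (size gs)%:R.
  have M0 : 0 <= M by rewrite le_max divr_ge0 // ltW.
  by apply: (lt_le_trans (archi_boundP M0)); rewrite ler_nat.
have Ne : 4 <= (size gs)%:R * e.
  by rewrite -ler_pdivrMr // ltW // (le_lt_trans _ sM) // le_max lexx.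
have gs0 : (0 < size gs)%N.
  by rewrite -(ltr0n R) -(pmulr_lgt0 _ e0) (lt_le_trans _ Ne).
pose beta x := f x - avg gs f x.
have betaC : sqle beta C by exact: sqle_sub_avg.
pose w x := bd g f x - bd g beta x.
have bC := sqle_bd g betaC.
have wW : sqle w W.
  move=> Y uY; have sN : (-1 : R) ^+ 2 = 1 by rewrite sqrrN expr1n.
  have := sqle_lin sN gK bC uY.
  under eq_bigr do rewrite mulN1r.
  by move/le_trans; apply; rewrite /W; lra.
have small x : w x ^+ 2 <= eta.
  have [n [z [n0 zinj fo]]] := fol ([seq h^-1%g | h <- gs] ++ [:: x; (g^-1 * x)%g]) e e0.
  apply: (le_trans (defect_bound ugs C0 e0 e2 Ne betaC wW n0 zinj fo)).
  suff : 32 * (C / e) * ((size gs)%:R * e)^-1 <= eta / 2 by lra.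
  have N0 : 0 < (size gs)%:R :> R by rewrite ltr0n.
  have : 64 * C / (e ^+ 2 * eta) <= (size gs)%:R.
    by rewrite ltW // (le_lt_trans _ sM) // le_max lexx orbT.
  rewrite ler_pdivrMr ?mulr_gt0 ?exprn_gt0 // => H.
  have -> : 32 * (C / e) * ((size gs)%:R * e)^-1 = 32 * C / ((size gs)%:R * e ^+ 2).
    by field; rewrite !gt_eqF.
  rewrite ler_pdivrMr ?mulr_gt0 ?exprn_gt0 //.
  rewrite -subr_ge0; move: H; rewrite -subr_ge0; nra.
apply: (@le_trans _ _ (2 * \sum_(x <- X) w x ^+ 2 + 2 * \sum_(x <- X) bd g beta x ^+ 2)).
  rewrite !big_distrr -big_split /=; apply: ler_sum => x _.
  rewrite {1}(_ : bd g f x = w x + bd g beta x); last by rewrite /w subrK.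
  by have := sqr_ge0 (w x - bd g beta x); nra.
have H1 := bC X uX.
have H2 : \sum_(x <- X) w x ^+ 2 <= 2^-1.
  apply: (@le_trans _ _ (\sum_(x <- X) eta)); first exact: ler_sum.
  rewrite big_const_seq count_predT iter_addr_0 -[eta *+ _]mulr_natl /eta.
  rewrite ler_pdivrMr ?mulr_gt0 ?ltr0n // mulKf //.
  by rewrite ler_nat.
lra.
Qed.

End Alternative.

(** * Functionals above a convex cone *)

(** Hahn-Banach for finitely supported sequences: a convex cone [V] in their
    product with the line that contains no [(0, s)] with [s > 0] lies below the
    graph of a functional, which is bounded because of the units in [V]. *)
Section Cone.
Variables (R : realType) (V : (nat -> R) -> R -> Prop).
Hypotheses
  (VD : forall u s v t, V u s -> V v t -> V (fun i => u i + v i) (s + t))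
  (VZ : forall (a : R) u s, 0 < a -> V u s -> V (fun i => a * u i) (a * s))
  (V0 : forall u s, (forall i, u i = 0) -> V u s -> s <= 0)
  (Vunit : forall (k : nat) (a : R), `|a| = 1 -> V (fun i => a * (i == k)%:R) (-1)).

Let dominated (hs : seq R) := forall u s, V u s ->
  (forall i, (size hs <= i)%N -> u i = 0) ->
  s <= \sum_(i < size hs) hs`_i * u i.

(** Vectors with positive coordinate [k] bound the new value from below, those with negative one
    from above, and [sep] compares the bounds. The units make both families nonempty, so [sup lo]
    works. *)
Let extend hs : dominated hs -> exists c, dominated (rcons hs c).
Proof.
move=> hsQ; set k := size hs.
pose A (u : nat -> R) := \sum_(i < k) hs`_i * u i.
have AD (u v : nat -> R) (a b : R) : A (fun i => a * u i + b * v i) = a * A u + b * A v.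
  by rewrite /A !big_distrr -big_split /=; apply: eq_bigr => i _; ring.
pose lo := [set c | exists (u : nat -> R) s, [/\ V u s, forall i, (k < i)%N -> u i = 0, 0 < u k
   & c = (s - A u) / u k]]%classic.
have sep c v t : lo c -> V v t -> (forall i, (k < i)%N -> v i = 0) -> v k < 0 ->
    c <= (t - A v) / v k.
  move=> [u [s [Vu u0 uk ->]]] Vv v0 vk.
  have vk' : 0 < - v k by rewrite oppr_gt0.
  (* This positive combination cancels coordinate [k]. *)
  have H : - v k * s + u k * t <= A (fun i => - v k * u i + u k * v i).
    apply: hsQ => [|i]; first by apply: VD; exact: VZ.
    rewrite leq_eqVlt => /predU1P[<-|ki]; first by rewrite -/k; ring.
    by rewrite (u0 i ki) (v0 i ki) !mulr0 addr0.
  rewrite AD in H.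
  rewrite ler_ndivlMr // mulrAC ler_pdivlMr //; lra.
have unit_lo : lo ((-1 - A (fun i => 1 * (i == k)%:R)) / (1 * (k == k)%:R)).
  exists (fun i => 1 * (i == k)%:R), (-1); split => //.
  - by apply: Vunit; rewrite normr1.
  - by move=> i ki; rewrite gtn_eqF // mulr0.
  - by rewrite eqxx mulr1 ltr01.
have ub : has_sup lo.
  split; first by eexists; exact: unit_lo.
  exists ((-1 - A (fun i => -1 * (i == k)%:R)) / (-1 * (k == k)%:R)) => c loc.
  apply: sep loc _ _ _.
  - by apply: Vunit; rewrite normrN normr1.
  - by move=> i ki; rewrite gtn_eqF // mulr0.
  - by rewrite eqxx mulr1 oppr_lt0 ltr01.
exists (sup lo) => u s Vu; rewrite size_rcons -/k => u0.
have -> : \sum_(i < k.+1) (rcons hs (sup lo))`_i * u i = A u + sup lo * u k.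
  rewrite big_ord_recr /= nth_rcons -/k ltnn eqxx; congr (_ + _).
  by apply: eq_bigr => i _; rewrite nth_rcons ltn_ord.
case: (ltgtP (u k) 0) => [uk|uk|uk].
- have : sup lo <= (s - A u) / u k by apply: ge_sup ub.1 _ => c loc; exact: sep loc Vu u0 uk.
  by rewrite ler_ndivlMr //; lra.
- have : (s - A u) / u k <= sup lo by apply: sup_upper_bound => //; exists u, s.
  by rewrite ler_pdivrMr //; lra.
- rewrite uk mulr0 addr0; apply: hsQ => // i; rewrite leq_eqVlt.
  by move=> /predU1P[<-//|]; exact: u0.
Qed.

Lemma cone_functional : exists h : nat -> R, (forall k, `|h k| <= 1) /\
  forall k u s, V u s -> (forall i, (k <= i)%N -> u i = 0) ->
    s <= \sum_(i < k) h i * u i.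
Proof.
(* The value at lists that are not dominated is arbitrary; the recursion from the empty list never
   meets them. *)
have [F HF] : {F : seq R -> R & forall hs, dominated hs -> dominated (rcons hs (F hs))}.
  apply: (@choice _ _ (fun hs c => dominated hs -> dominated (rcons hs c))) => hs.
  have [/extend[c hc]|nd] := pselect (dominated hs); first by exists c.
  by exists 0 => /nd.
pose H := fix H k := if k is k'.+1 then rcons (H k') (F (H k')) else [::].
pose h k := F (H k).
have HE k : H k = mkseq h k by elim: k => //= k IH; rewrite mkseqS -IH.
have Hd k : dominated (mkseq h k).
  rewrite -HE; elim: k => [|k IH] /=; last exact: HF.
  by move=> u s Vu u0; rewrite big_ord0; apply: V0 Vu => i; exact: u0.
have dom k u s : V u s -> (forall i, (k <= i)%N -> u i = 0) -> s <= \sum_(i < k) h i * u i.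
  move=> Vu u0; have := Hd k u s Vu; rewrite size_mkseq => /(_ u0).
  by under eq_bigr do rewrite nth_mkseq //.
exists h; split => // k.
have side a : `|a| = 1 -> -1 <= a * h k.
  move=> a1; have := dom k.+1 _ _ (Vunit k a1).
  rewrite big_ord_recr /= eqxx mulr1 big1 ?add0r 1?mulrC => [|i _]; last first.
    by rewrite ltn_eqF // !mulr0.
  by apply=> i ki; rewrite gtn_eqF // mulr0.
rewrite ler_norml; have := side 1 (normr1 _); have := side (-1).
by rewrite normrN normr1 => /(_ erefl); lra.
Qed.

End Cone.

(** * Isoperimetry for sets and functions *)

Section Isoperimetry.
Variables (R : realType) (G : groupType).

Lemma ler_sum_subset (F : G -> R) (Y Z : seq G) : uniq Y -> uniq Z ->
  {subset Y <= Z} -> (forall y, 0 <= F y) -> \sum_(y <- Y) F y <= \sum_(y <- Z) F y.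
Proof.
move=> uY uZ YZ F0; rewrite [leRHS](bigID (mem Y)) /=.
rewrite -[X in _ <= X + _]big_filter [X in _ <= X + _](perm_big Y); last first.
  apply: uniq_perm => // [|y]; first exact: filter_uniq.
  by rewrite mem_filter; case: (boolP (y \in Y)) => //= /YZ ->.
by rewrite lerDl; apply: sumr_ge0.
Qed.

Variables (m : nat) (b : 'I_m -> G) (e : R).
Hypothesis iso : forall S : seq G, uniq S -> S != [::] ->
  e * (size S)%:R <= \sum_j \sum_(x <- S) ((b j * x)%g \notin S)%:R.

(* Peeling off the lowest level [mu] of [phi] splits every difference
   [|phi y - phi x|] additively, so the bound for sets passes to functions. *)
Lemma iso_fun (Z : seq G) (phi : G -> R) : uniq Z -> (forall x, 0 <= phi x) ->
  (forall x, phi x != 0 -> x \in Z /\ forall j, (b j * x)%g \in Z) ->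
  e * \sum_(x <- Z) phi x <=
  \sum_j \sum_(y <- Z) `|phi ((b j)^-1 * y)%g - phi y|.
Proof.
move=> uZ; have [n] := ubnP (count (fun x => phi x != 0) Z).
elim: n => // n IH in phi *; rewrite ltnS => cn phi0 phiZ.
pose S := [seq x <- Z | phi x != 0].
have uS : uniq S by exact: filter_uniq.
have inS x : (x \in S) = (phi x != 0).
  rewrite mem_filter andb_idr // => px; exact: (phiZ x px).1.
have [S0|SN] := eqVneq S [::].
  rewrite big_seq big1 => [|x xZ].
    by rewrite mulr0; apply: sumr_ge0 => j _; apply: sumr_ge0.
  by apply/eqP; rewrite -[_ == _]negbK -inS S0.
have [x0 x0S x0min] : exists2 x0, x0 \in S & forall x, x \in S -> phi x0 <= phi x.
  elim: (S) SN => // a s IHs _; have [->|sN] := eqVneq s [::].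
    by exists a; rewrite ?mem_head // => x; rewrite inE => /eqP->.
  have [x1 x1s x1m] := IHs sN.
  have [le|/ltW le] := leP (phi a) (phi x1).
    exists a; rewrite ?mem_head // => x; rewrite inE => /predU1P[->//|/x1m].
    exact: le_trans.
  exists x1; first by rewrite inE x1s orbT.
  by move=> x; rewrite inE => /predU1P[->//|/x1m].
set mu := phi x0.
have mu0 : 0 < mu by rewrite lt_neqAle phi0 eq_sym -inS x0S.
(* Subtracting the minimum on the support keeps the function nonnegative and removes [x0] from the
   support. *)
pose psi x := phi x - mu * (x \in S)%:R.
have off x : x \notin S -> phi x = 0 by rewrite inS negbK => /eqP.
have psi0 x : 0 <= psi x.
  rewrite /psi; case: (boolP (x \in S)) => [/x0min|_]; rewrite ?mulr1 ?mulr0 ?subr0 //.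
  by rewrite subr_ge0.
have psiN x : psi x != 0 -> phi x != 0.
  apply: contra_neq => px; rewrite /psi px inS px eqxx mulr0 subr0 //.
have psiZ x : psi x != 0 -> x \in Z /\ forall j, (b j * x)%g \in Z by move=> /psiN/phiZ.
have cpsi : (count (fun x => psi x != 0%R) Z < n)%N.
  apply: leq_trans cn.
  rewrite -!size_filter -/S (perm_size (_ : perm_eq S (x0 :: rem x0 S))); last first.
    exact: perm_to_rem.
  rewrite /= ltnS; apply: uniq_leq_size; first exact: filter_uniq.
  move=> x; rewrite mem_filter (mem_rem_uniq _ uS) !inE inS => /andP[px _].
  rewrite psiN // andbT; apply: contra_neq px => ->.
  by rewrite /psi x0S mulr1 subrr.
have := IH psi cpsi psi0 psiZ.
have sumphi : \sum_(x <- Z) phi x = \sum_(x <- Z) psi x + mu * (size S)%:R.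
  rewrite /psi sumrB -big_distrr /= size_filter -sum1_count natr_sum.
  rewrite [X in _ - _ * X + _](_ : _ = \sum_(x <- Z | phi x != 0) 1).
    by rewrite subrK.
  by rewrite [RHS]big_mkcond; apply: eq_bigr => x _; rewrite inS; case: ifP.
have split_abs x y : `|phi x - phi y| =
    `|psi x - psi y| + mu * `|(x \in S)%:R - (y \in S)%:R|.
  have [xS|xS] := boolP (x \in S); have [yS|yS] := boolP (y \in S).
  - rewrite /psi xS yS subrr normr0 mulr0 addr0; congr `|_|; ring.
  - rewrite /psi xS (negbTE yS) (off y yS) /= !(mulr0, mulr1, subr0, normr1).
    by rewrite !ger0_norm ?subrK // subr_ge0 x0min.
  - rewrite /psi (negbTE xS) yS (off x xS) /= !(mulr0, mulr1, subr0, sub0r, oppr0, normrN, normr1).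
    by rewrite !ger0_norm ?subrK // subr_ge0 x0min.
  - by rewrite /psi (negbTE xS) (negbTE yS) (off x xS) (off y yS) !mulr0 !subr0 normr0 mulr0 addr0.
have isoS := iso uS SN.
(* A point of [S] leaving [S] under [b j] lands in [Z], where the indicator and its translate
   differ. *)
have bdS : \sum_j \sum_(x <- S) ((b j * x)%g \notin S)%:R <=
    \sum_j \sum_(y <- Z) `|((b j)^-1 * y \in S)%g%:R - (y \in S)%:R| :> R.
  apply: ler_sum => j _.
  have -> : \sum_(x <- S) ((b j * x)%g \notin S)%:R =
      \sum_(y <- [seq (b j * x)%g | x <- S]) `|((b j)^-1 * y \in S)%g%:R - (y \in S)%:R| :> R.
    rewrite big_map !big_seq; apply: eq_bigr => x xS; rewrite mulKg xS.
    by case: (_ \in _); rewrite ?subrr ?normr0 ?subr0 ?normr1.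
  apply: ler_sum_subset => //; first by rewrite map_inj_uniq //; exact: mulgI.
  by move=> y /mapP[x + ->]; rewrite inS => /phiZ[].
have -> : \sum_j \sum_(y <- Z) `|phi ((b j)^-1 * y)%g - phi y| =
    \sum_j \sum_(y <- Z) `|psi ((b j)^-1 * y)%g - psi y| +
    mu * \sum_j \sum_(y <- Z) `|((b j)^-1 * y \in S)%g%:R - (y \in S)%:R|.
  rewrite big_distrr -big_split; apply: eq_bigr => j _.
  by rewrite big_distrr -big_split; apply: eq_bigr => y _; exact: split_abs.
rewrite sumphi mulrDr => Hpsi.
apply: lerD => //; rewrite mulrCA; apply: ler_wpM2l; first exact: ltW.
exact: le_trans bdS.
Qed.

End Isoperimetry.

(** * Invariant means *)

Section Mean.
Variables (R : realType) (G : groupType).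

Lemma bounded_fun_le (f : G -> R) M : (forall x, `|f x| <= M) -> bounded_fun f.
Proof.
move=> fM; exists M; split; rewrite ?num_real // => K MK x _ /=.
by rewrite (le_trans (fM x)) // ltW.
Qed.

Variable mean : (G -> R) -> R.
Hypothesis hm : invariant_mean mean.

Let meanD (a : R) (f h : G -> R) : bounded_fun f -> bounded_fun h ->
  mean (fun x => a * f x + h x) = a * mean f + mean h.
Proof. by case: hm => + _ _ _; exact. Qed.

Lemma mean_cst (a : R) : mean (fun=> a) = a.
Proof.
have one : bounded_fun (fun _ : G => 1 : R).
  by apply: (bounded_fun_le (M := 1)) => x; rewrite normr1.
have E1 : mean (fun=> 1) = 1 by case: hm.
by have := meanD (a - 1) one one; rewrite E1 !mulr1 subrK.
Qed.

Lemma mean_ge (a : R) (f : G -> R) M :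
  (forall x, `|f x| <= M) -> (forall x, a <= f x) -> a <= mean f.
Proof.
move=> fM af; have fb := bounded_fun_le fM.
have cb (c : R) : bounded_fun (fun _ : G => c) by exact: (bounded_fun_le (M := `|c|)).
have pos : 0 <= mean (fun x => 1 * f x + - a).
  case: hm => _ + _ _; apply=> [|x]; last by rewrite mul1r subr_ge0.
  apply: (bounded_fun_le (M := M + `|a|)) => x.
  by rewrite mul1r (le_trans (ler_normB _ _)) // lerD2r.
by move: pos; rewrite meanD // mean_cst mul1r subr_ge0.
Qed.

(** Invariance annihilates each difference. The uniform bound is carried through the induction
    because linearity is available only for bounded functions. *)
Lemma mean_coboundary (I : Type) (r : seq I) (H : I -> G -> R) (b : I -> G) :
  (forall j x, `|H j x| <= 1) ->
  (forall x, `|\sum_(j <- r) (H j (b j * x)%g - H j x)| <= 2 * (size r)%:R) /\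
  mean (fun x => \sum_(j <- r) (H j (b j * x)%g - H j x)) = 0.
Proof.
move=> H1.
have step j x : `|H j (b j * x)%g - H j x| <= 2.
  by rewrite (le_trans (ler_normB _ _)) // (_ : 2 = 1 + 1) // lerD.
elim: r => [|j r [IH1 IH2]].
  split=> [x|]; first by rewrite big_nil normr0 mulr0.
  by under eq_fun do rewrite big_nil; exact: mean_cst.
split=> [x|].
  rewrite big_cons (le_trans (ler_normD _ _)) //= -natr1.
  by have := IH1 x; have := step j x; lra.
under eq_fun do rewrite big_cons -[H j _ - _]mul1r.
rewrite meanD; [|exact: bounded_fun_le (step j)|exact: bounded_fun_le IH1].
rewrite IH2 addr0 mul1r.
have Hb : bounded_fun (H j) by exact: bounded_fun_le (H1 j).
have Hb' : bounded_fun (fun x => H j (b j * x)%g).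
  by apply: (bounded_fun_le (M := 1)) => x; exact: H1.
have -> : (fun x => H j (b j * x)%g - H j x) = (fun x => -1 * H j x + H j (b j * x)%g).
  by apply/funext => x; rewrite mulN1r addrC.
rewrite meanD //.
have -> : mean (fun x => H j (b j * x)%g) = mean (H j).
  case: hm => _ _ _ /(_ (b j)^-1%g _ Hb) <-.
  by congr mean; apply/funext => x; rewrite /left_translate invgK.
by rewrite mulN1r addNr.
Qed.

End Mean.

(** * Folner sets from an invariant mean *)

Lemma amenable_folner (R : realType) (G : groupType) :
  countable [set: G]%classic -> amenable R G -> folner R G.
Proof.
move=> /countable_injP[code0 codeI0] [mean hm] B e e0; apply: contrapT => nofol.
have [code codeI] : exists code : G -> nat, injective code.
  by exists code0 => x y; apply: codeI0; rewrite inE.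
pose m := size B; pose b (j : 'I_m) := tnth (in_tuple B) j.
(* Countability codes pairs of an index and a point by natural numbers, as [cone_functional]
   expects. *)
pose pos (j : 'I_m) (x : G) : nat := pickle (val j, code x).
have posE j x k y : (pos j x == pos k y) = (j == k) && (x == y).
  apply/eqP/andP => [/(pcan_inj pickleK)[/val_inj-> /codeI->]|[/eqP-> /eqP->]] //.
(* A set violating this inequality would be a Folner set for [B] and [e]. *)
have iso (S : seq G) : uniq S -> S != [::] ->
    e * (size S)%:R <= \sum_j \sum_(x <- S) ((b j * x)%g \notin S)%:R.
  move=> uS SN; rewrite leNgt; apply/negP => lt; apply: nofol.
  exists (size S), (tnth (in_tuple S)); split.
  - by rewrite lt0n size_eq0.
  - exact/tuple_uniqP.
  - have cod x : (x \in codom (tnth (in_tuple S))) = (x \in S).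
      by apply/codomP/idP => [[i ->]|/(tnthP (in_tuple S))//]; exact: mem_tnth.
    rewrite (big_tnth _ _ B) /=; apply: le_trans (ltW lt); apply: ler_sum => j _.
    by rewrite [leRHS]big_tnth; apply: ler_sum => i _; rewrite cod.
pose d (phi : G -> R) j y := phi ((b j)^-1 * y)%g - phi y.
(* The hypograph of [u |-> sup_phi (e ||phi||_1 - ||u - d phi||_1)]. *)
pose V (u : nat -> R) (s : R) := exists (phi : G -> R) (X : seq G),
  [/\ forall x, 0 <= phi x, forall x, phi x != 0 -> x \in X &
   forall Z, uniq Z -> {subset X <= Z} ->
     s + \sum_j \sum_(y <- Z) `|u (pos j y) - d phi j y| <= e * \sum_(y <- Z) phi y].
have VD u s v t : V u s -> V v t -> V (fun i => u i + v i) (s + t).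
  move=> [f [X [f0 fX fb]]] [g [Y [g0 gY gb]]].
  exists (fun x => f x + g x), (X ++ Y); split => [x|x|Z uZ XYZ]; first exact: addr_ge0.
    rewrite mem_cat; have [/fX->//|/negbNE/eqP->] := boolP (f x != 0).
    by rewrite add0r => /gY ->; rewrite orbT.
  have hX : {subset X <= Z} by move=> x xX; apply: XYZ; rewrite mem_cat xX.
  have hY : {subset Y <= Z} by move=> x xY; apply: XYZ; rewrite mem_cat xY orbT.
  have := lerD (fb Z uZ hX) (gb Z uZ hY).
  rewrite -mulrDr -big_split /=; apply: le_trans.
  rewrite addrACA lerD2l -big_split /=; apply: ler_sum => j _.
  rewrite -big_split /=; apply: ler_sum => y _.
  rewrite (_ : _ - _ = (u (pos j y) - d f j y) + (v (pos j y) - d g j y)) ?ler_normD //.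
  rewrite /d; ring.
have VZ a u s : 0 < a -> V u s -> V (fun i => a * u i) (a * s).
  move=> a0 [f [X [f0 fX fb]]]; exists (fun x => a * f x), X; split => [x|x|Z uZ XZ].
  - by rewrite mulr_ge0 // ltW.
  - by rewrite mulf_eq0 negb_or => /andP[_ /fX].
  - rewrite -big_distrr /= mulrCA.
    apply: le_trans (ler_wpM2l (ltW a0) (fb Z uZ XZ)); rewrite mulrDr lerD2l.
    rewrite le_eqVlt; apply/orP; left; apply/eqP.
    rewrite big_distrr; apply: eq_bigr => j _; rewrite big_distrr; apply: eq_bigr => y _.
    rewrite (_ : a * u _ - _ = a * (u (pos j y) - d f j y)); last by rewrite /d; ring.
    by rewrite normrM gtr0_norm.
have V0 u s : (forall i, u i = 0) -> V u s -> s <= 0.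
  move=> u0 [f [X [f0 fX fb]]].
  (* [Z] contains the support of [f] and its translates, as [iso_fun] requires; then
     [s + ||d f|| <= e ||f|| <= ||d f||]. *)
  pose Z := undup (X ++ [seq (b j * x)%g | j <- enum 'I_m, x <- X]).
  have XZ : {subset X <= Z} by move=> x xX; rewrite mem_undup mem_cat xX.
  have := fb Z (undup_uniq _) XZ.
  under [X in _ + X <= _ -> _]eq_bigr do under eq_bigr do rewrite u0 sub0r normrN.
  have : e * \sum_(y <- Z) f y <= \sum_j \sum_(y <- Z) `|f ((b j)^-1 * y)%g - f y|.
    apply: (iso_fun iso) => [||x fx] //; first exact: undup_uniq.
    split; first exact/XZ/fX.
    move=> j; rewrite mem_undup mem_cat; apply/orP; right; apply/allpairsP.
    by exists (j, x); rewrite mem_enum fX.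
  rewrite /d; lra.
have Vunit k a : `|a| = 1 -> V (fun i => a * (i == k)%:R) (-1).
  (* With [phi = 0] it remains to see that a unit vector has 1-norm at most one; the sum is zero
     when [k] codes no pair. *)
  move=> a1; exists (fun=> 0), [::]; split => [//|x|Z uZ _]; first by rewrite eqxx.
  rewrite [X in e * X]big1 // mulr0 addrC subr_le0.
  have -> : \sum_j \sum_(y <- Z) `|a * (pos j y == k)%:R - d (fun=> 0) j y| =
      \sum_j \sum_(y <- Z) (pos j y == k)%:R.
    apply: eq_bigr => j _; apply: eq_bigr => y _.
    by rewrite /d !subr0 normrM a1 mul1r normr_nat.
  have [[j0 [y0 <-]]|no] := pselect (exists j0 y0, pos j0 y0 = k).
    rewrite (bigD1 j0) //= [X in _ + X]big1 => [|j /negbTE jN].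
      rewrite addr0; under eq_bigr do rewrite posE eqxx /=.
      have -> : \sum_(y <- Z) (y == y0)%:R = (count_mem y0 Z)%:R :> R.
        rewrite -sum1_count natr_sum [RHS]big_mkcond.
        by apply: eq_bigr => y _ /=; case: eqP.
      by rewrite lern1 count_uniq_mem // leq_b1.
    by rewrite big1 // => y _; rewrite posE jN.
  rewrite big1 // => j _; rewrite big1 // => y _; case: eqP => // E.
  by case: no; exists j, y.
have [h [h1 hV]] := cone_functional VD VZ V0 Vunit.
pose H j x := h (pos j x).
have [Hb M0] := mean_coboundary hm (index_enum 'I_m) b (fun j x => h1 (pos j x)).
suff : e <= 0 by lra.
rewrite -M0; apply: mean_ge Hb _ => // x.
(* In coded form, [u] is [d] of the point mass at [x], so that point mass witnesses [V u e]; pairing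
   [u] with [h] gives the function being averaged. *)
pose u i : R := \sum_j ((i == pos j (b j * x)%g)%:R - (i == pos j x)%:R).
have Vu : V u e.
  exists (fun y => (y == x)%:R), [:: x]; split => [y|y|Z uZ xZ]; first exact: ler0n.
    by rewrite inE; case: (y == x); rewrite ?eqxx.
  rewrite -natr_sum [X in e + X]big1 => [|j _]; last first.
    rewrite big1 // => y _; apply/eqP; rewrite normr_eq0 subr_eq0; apply/eqP.
    rewrite /u (bigD1 j) //= big1 ?addr0 => [|k /negbTE kj]; last first.
      by rewrite !posE eq_sym kj subrr.
    rewrite !posE !eqxx /d /=; congr (_%:R - _).
    by congr (nat_of_bool _); apply/eqP/eqP => [->|<-]; rewrite ?mulKg ?mulVKg.
  rewrite addr0; suff -> : (\sum_(y <- Z) (y == x) = 1)%N by rewrite mulr1.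
  have <- : count_mem x Z = 1%N by rewrite count_uniq_mem // xZ ?mem_head.
  rewrite -sum1_count.
  by rewrite [RHS]big_mkcond; apply: eq_bigr => y _ /=; case: eqP.
(* The successor puts [K] strictly beyond every coordinate where [u] can be nonzero. *)
pose K := (\sum_j (pos j (b j * x)%g + pos j x)).+1.
have big j : (pos j (b j * x)%g < K)%N /\ (pos j x < K)%N.
  by rewrite /K (bigD1 j) //=; split; rewrite ltnS -addnA ?leq_addr // addnCA leq_addr.
have pick p : (p < K)%N -> \sum_(i < K) h i * ((i : nat) == p)%:R = h p.
  move=> pK; rewrite (bigD1 (Ordinal pK)) //= eqxx mulr1 big1 ?addr0 // => i /negbTE iN.
  by move: iN; rewrite -val_eqE /= => ->; rewrite mulr0.
apply: le_trans (hV K u e Vu _) _ => [i Ki|].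
  rewrite /u big1 // => j _; have [l1 l2] := big j.
  by rewrite !gtn_eqF ?subrr // (leq_trans _ Ki).
rewrite /u; under eq_bigr do rewrite big_distrr /=.
rewrite exchange_big /= le_eqVlt; apply/orP; left; apply/eqP; apply: eq_bigr => j _.
have [l1 l2] := big j; rewrite -(pick _ l1) -(pick _ l2) -sumrB.
by apply: eq_bigr => i _; rewrite mulrBr.
Qed.

(** * Complex cocycles and the conclusion *)

Section Complex.
Variables (R : realType) (G : groupType).
Local Notation normc := ComplexField.Normc.normc.

Lemma sqr_normc (z : R[i]) : normc z ^+ 2 = complex.Re z ^+ 2 + complex.Im z ^+ 2.
Proof. by case: z => a b /=; rewrite sqr_sqrtr // addr_ge0 ?sqr_ge0. Qed.

Lemma l2norm_sq_le (f : G -> R[i]) K :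
  (l2norm_sq f <= K%:E)%E <-> sqle (fun x => normc (f x)) K.
Proof.
split=> [fK X uX|fK].
  rewrite -lee_fin -sumEFin; apply: le_trans fK; apply: esum_ge.
  exists [set` X]%classic; first by split => //; exact: finite_seq.
  by rewrite -fsbig_seq.
apply: ge_ereal_sup => _ [X [finX _] <-].
by rewrite fsbig_finite //= sumEFin lee_fin; apply: fK; exact: finmap.fset_uniq.
Qed.

(** Membership in [ell2] ensures that [fine] loses no information. *)
Lemma l2norm_le (f : G -> R[i]) K : 0 <= K -> ell2 f ->
  l2norm f <= K <-> sqle (fun x => normc (f x)) (K ^+ 2).
Proof.
move=> K0 fl2; have f0 : (0 <= l2norm_sq f)%E.
  by apply: esum_ge0 => x _; rewrite lee_fin sqr_ge0.
rewrite -l2norm_sq_le -[in X in _ <-> X](@fineK _ (l2norm_sq f)) ?ge0_fin_numE //.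
by rewrite lee_fin /l2norm -{1}(ger0_norm K0) -(sqrtr_sqr K) ler_sqrt ?sqr_ge0.
Qed.

Section Part.
Variable part : R[i] -> R.
Hypotheses (partD : {morph part : a b / a + b}) (part_le : forall z, part z ^+ 2 <= normc z ^+ 2).

Lemma sqle_part (f : G -> R[i]) K :
  sqle (fun x => normc (f x)) K -> sqle (fun x => part (f x)) K.
Proof.
move=> fK X uX; apply: le_trans (fK X uX).
by apply: ler_sum => x _; exact: part_le.
Qed.

Lemma cocycle_part_bounded (c : G -> G -> R[i]) C : folner R G ->
  l2_cocycle c -> 0 < C -> infinite_set [set g | l2norm (c g) <= C]%classic ->
  forall g, sqle (fun x => part (c g x)) (8 * C ^+ 2 + 1).
Proof.
move=> fol [cl2 cD] C0 infC g.
pose f x := - part (c x x).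
(* The cocycle identity for [x = h (h^-1 x)], evaluated at [x], makes [f] a primitive of the
   cocycle, though perhaps not a square-summable one. *)
have bdE h : bd h f = fun x => part (c h x).
  apply/funext => x; rewrite /bd /f.
  by rewrite -[X in _ - - part (c X _)](mulVKg h x) cD partD /left_translate; ring.
rewrite -bdE; apply: bounded_of_infinite => //.
- move=> h; exists (l2norm (c h) ^+ 2); rewrite bdE; apply: sqle_part.
  by rewrite -l2norm_le // sqrtr_ge0.
- exact: exprn_gt0.
- apply: contra_not infC; apply: sub_finite_set => h /= hC.
  by rewrite bdE; apply: sqle_part; rewrite -l2norm_le // ltW.
Qed.

End Part.
End Complex.

Theorem theorem2p5 (R : realType) (G : groupType)
    (hcount : countable [set: G]%classic) (hamen : amenable R G)
    (c : G -> (G -> complex R)) (hc : l2_cocycle c) :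
  bounded_cocycle c \/ proper_cocycle c.
Proof.
have fol := amenable_folner hcount hamen.
have [proper|notproper] := pselect (proper_cocycle c); [by right|left].
have [C C0 infC] : exists2 C, 0 < C & infinite_set [set g | l2norm (c g) <= C]%classic.
  apply: contrapT => noC; apply: notproper => C C0; apply: contrapT => infC.
  by apply: noC; exists C.
have reD : {morph @complex.Re R : a b / a + b} by case=> ? ? [].
have imD : {morph @complex.Im R : a b / a + b} by case=> ? ? [].
have re_le (z : R[i]) : complex.Re z ^+ 2 <= ComplexField.Normc.normc z ^+ 2
  by rewrite sqr_normc lerDl sqr_ge0.
have im_le (z : R[i]) : complex.Im z ^+ 2 <= ComplexField.Normc.normc z ^+ 2
  by rewrite sqr_normc lerDr sqr_ge0.
have reC := cocycle_part_bounded reD re_le fol hc C0 infC.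
have imC := cocycle_part_bounded imD im_le fol hc C0 infC.
(* Real and imaginary parts contribute [8 C^2 + 1] each. *)
pose K := 16 * C ^+ 2 + 2.
exists (Num.sqrt K) => _ [g _ <-]; rewrite l2norm_le ?sqrtr_ge0 //; last by case: hc.
have K0 : 0 <= K by rewrite /K; have := sqr_ge0 C; lra.
rewrite sqr_sqrtr // => X uX; under eq_bigr do rewrite sqr_normc.
rewrite big_split /=.
have := reC g X uX; have := imC g X uX; rewrite /K; lra.
Qed.
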